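(* Let $\Lambda=\{\lambda_n,\mu_n\}_{n=1}^{\infty}$ belong to the class $ABC$, let $\eta=\sup_n|\arg\lambda_n|$, and let $-\infty<\gamma<\beta<\infty$. Suppose that the Taylor–Dirichlet series \[ f(z)=\sum_{n=1}^{\infty}\Big(\sum_{k=0}^{\mu_n-1}c_{n,k}z^k\Big)e^{\lambda_n z},\qquad c_{n,k}\in\mathbb{C}, \] defines an analytic function in the sector $\Theta_{\eta,\beta}$ (the series converging uniformly on compact subsets of $\Theta_{\eta,\beta}$), and that $f\in L^p(\gamma,\beta)$ for some $p\ge1$. Then $f$ belongs to the closed span of $E_\Lambda$ in $L^p(\gamma,\beta)$.
   Context: A multiplicity sequence $\Lambda=\{\lambda_n,\mu_n\}_{n=1}^\infty$ consists of distinct nonzero complex numbers $\lambda_n$ with $|\lambda_n|\to\infty$, $|\lambda_n|\le|\lambda_{n+1}|$, and positive integers $\mu_n$. $A^0_{|z|}$ is the space of entire functions $F$ with: for every $\epsilon>0$ there is $M_\epsilon$ with $|F(z)|\le M_\epsilon e^{\epsilon|z|}$ on $\mathbb{C}$. $\Lambda$ is an interpolating variety for $A^0_{|z|}$ if for every doubly indexed complex sequence $(a_{n,k})_{n\in\mathbb{N},0\le k\le\mu_n-1}$ with $\sup_n\sum_{k}|a_{n,k}|e^{-\epsilon|\lambda_n|}<\infty$ for every $\epsilon>0$ there is $f\in A^0_{|z|}$ with $f^{(k)}(\lambda_n)/k!=a_{n,k}$ for all $n,k$. $\Lambda\in ABC$ means: (A) $\sum_n\mu_n/|\lambda_n|<\infty$;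 (B) $\sup_n|\arg\lambda_n|<\pi/2$; (C) $\Lambda$ is an interpolating variety for $A^0_{|z|}$. $E_\Lambda=\{x^ke^{\lambda_n x}:n\in\mathbb{N},\ 0\le k\le\mu_n-1\}$. For $\eta\in(0,\pi/2)$, $\Theta_{\eta,\beta}=\{z:\Re z<\beta,\ |\Im z|\le|\Re(z-\beta)|/\tan\eta\}$; for $\eta=0$, $\Theta_{0,\beta}=\{\Re z<\beta\}$. *)

(* Defs.v *)
From Stdlib Require Import Reals.
From Coquelicot Require Import Coquelicot.
From mathcomp Require Import all_boot all_algebra.
From mathcomp Require Import all_classical all_reals all_analysis.
From mathcomp Require Import Rstruct Rstruct_topology.

Local Open Scope R_scope.

Definition Cexp (z : C) : C :=
  (exp (Re z) * Rtrigo_def.cos (Im z), exp (Re z) * Rtrigo_def.sin (Im z)).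

Fixpoint Cpow (z : C) (k : nat) : C :=
  match k with O => RtoC 1 | S k' => Cmult (Cpow z k') z end.

Fixpoint Csum (m : nat) (f : nat -> C) : C :=
  match m with O => RtoC 0 | S m' => Cplus (Csum m' f) (f m') end.
Fixpoint Rsum (m : nat) (f : nat -> R) : R :=
  match m with O => 0 | S m' => Rsum m' f + f m' end.

(* principal argument, with values in (-PI, PI] (arg 0 := 0) *)
Definition Carg (z : C) : R :=
  let x := Re z in let y := Im z in
  if Rlt_dec 0 x then Ratan.atan (y / x)
  else if Rlt_dec x 0 then
    (if Rle_dec 0 y then Ratan.atan (y / x) + Rtrigo1.PI else Ratan.atan (y / x) - Rtrigo1.PI)
  else if Rlt_dec 0 y then Rtrigo1.PI / 2
  else if Rlt_dec y 0 then - (Rtrigo1.PI / 2)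
  else 0.

(* Lambda = {lam n, mu n}_n (indexed from n = 0) *)
Definition multiplicity_sequence (lam : nat -> C) (mu : nat -> nat) : Prop :=
  (forall n m, lam n = lam m -> n = m) /\
  (forall n, lam n <> RtoC 0) /\
  (forall n, Cmod (lam n) <= Cmod (lam (S n))) /\
  (forall M : R, exists N : nat, forall n, (N <= n)%nat -> M <= Cmod (lam n)) /\
  (forall n, (1 <= mu n)%nat).

Definition in_A0 (F : C -> C) : Prop :=
  forall eps : R, 0 < eps ->
    exists M : R, forall z : C, Cmod (F z) <= M * exp (eps * Cmod z).

(* D 0 is entire, and D k is its k-th complex derivative *)
Definition deriv_tower (D : nat -> C -> C) : Prop :=
  forall (k : nat) (z : C),
    @Coquelicot.Derive.is_derive C_AbsRing C_NormedModule (D k) z (D (S k) z).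

Definition interpolating_variety_A0 (lam : nat -> C) (mu : nat -> nat) : Prop :=
  forall a : nat -> nat -> C,
    (forall eps : R, 0 < eps -> exists B : R, forall n : nat,
        Rsum (mu n) (fun k => Cmod (a n k)) * exp (- eps * Cmod (lam n)) <= B) ->
    exists D : nat -> C -> C,
      deriv_tower D /\ in_A0 (D O) /\
      (forall n k, (k < mu n)%nat ->
         Cdiv (D k (lam n)) (RtoC (INR (Stdlib.Arith.Factorial.fact k))) = a n k).

Definition class_ABC (lam : nat -> C) (mu : nat -> nat) : Prop :=
  multiplicity_sequence lam mu /\
  (* (A) *) Coquelicot.Series.ex_series (fun n => INR (mu n) / Cmod (lam n)) /\
  (* (B) sup_n |arg lam_n| < pi/2 *)
  (exists e : R, e < Rtrigo1.PI / 2 /\ forall n, Rabs (Carg (lam n)) <= e) /\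
  (* (C) *) interpolating_variety_A0 lam mu.

Definition Theta (eta beta : R) (z : C) : Prop :=
  if Rlt_dec 0 eta then
    Re z < beta /\ Rabs (Im z) <= Rabs (Re z - beta) / Rtrigo1.tan eta
  else Re z < beta.

(* N-th partial sum  sum_{n<N} (sum_{k<mu n} c n k z^k) e^{lam n z};
   for arbitrary coefficients this is a generic element of span E_Lambda *)
Definition TD_partial (c : nat -> nat -> C) (lam : nat -> C) (mu : nat -> nat)
    (N : nat) (z : C) : C :=
  Csum N (fun n => Cmult (Csum (mu n) (fun k => Cmult (c n k) (Cpow z k)))
                         (Cexp (Cmult (lam n) z))).

Definition compactC (K : C -> Prop) : Prop :=
  forall u : nat -> C, (forall n, K (u n)) ->
    exists (phi : nat -> nat) (l : C),
      (forall n, (phi n < phi (S n))%nat) /\ K l /\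
      (forall eps : R, 0 < eps -> exists N : nat, forall n, (N <= n)%nat ->
          Cmod (Cminus (u (phi n)) l) < eps).

Definition unif_cvg_on_compacts (S : C -> Prop) (s : nat -> C -> C) (f : C -> C) : Prop :=
  forall K : C -> Prop, compactC K -> (forall z, K z -> S z) ->
    forall eps : R, 0 < eps -> exists N0 : nat, forall N, (N0 <= N)%nat ->
      forall z, K z -> Cmod (Cminus (s N z) (f z)) <= eps.

Definition Ioo (a b : R) : set R := [set x : R | (a < x)%R /\ (x < b)%R].

(* Main.v *)
Require Import Defs.
From HB Require Import structures.
From Stdlib Require Import Reals.
From Stdlib Require Lra.
From Coquelicot Require Import Coquelicot.
From mathcomp Require Import all_boot all_order all_algebra.
From mathcomp Require Import all_classical all_reals all_analysis.
From mathcomp Require Import Rstruct Rstruct_topology.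
From mathcomp Require Import measurable_realfun lra.

(* For small [t > 0] the translate [x |-> f (x - t)] is, on [(gamma, beta)], a uniform
   limit of partial sums evaluated at [x - t], because [[gamma - t, beta - t]] is a compact
   subset of the sector; expanding [(x - t)^k] and [e^(lam_n (x - t))] shows that these
   translated partial sums lie in the span of [E_Lambda].  It remains to let [t] tend to
   [0] in L^p: away from [beta] use the uniform continuity of [f], and near [beta] use
   that the integrals of [|f|^p] and of its translate over a short interval are small. *)

Local Open Scope classical_set_scope.

(** * Lebesgue integrals of translates *)

Section translation.
Import Order.TTheory GRing.Theory Num.Theory.
Local Open Scope ring_scope.
Variable K : realType.
Local Notation leb := (@lebesgue_measure K).

Let measurable_shift (t : K) :
  @measurable_fun _ _ (measurableTypeR K) (measurableTypeR K) setT (fun x => x - t).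
Proof. by apply: measurable_funB. Qed.

Lemma preimage_shift_itv (t : K) (b0 b1 : bool) (a b : K) :
  (fun x => x - t) @^-1` [set` Interval (BSide b0 a) (BSide b1 b)] =
  [set` Interval (BSide b0 (a + t)) (BSide b1 (b + t))].
Proof.
by apply/seteqP; split=> x /=; rewrite !in_itv; case: b0; case: b1 => /=;
  rewrite ?(lerBrDr,ltrBrDr,lerBlDr,ltrBlDr).
Qed.

(** Lebesgue measure is determined by its values on half-open intervals, and a shift preserves the
    length of such an interval. *)
Lemma lebesgue_measure_shift (t : K) (A : set K) :
  measurable (A : set (measurableTypeR K)) ->
  leb A = pushforward leb (fun x : measurableTypeR K => x - t : measurableTypeR K) A.
Proof.
pose sh_mixin := isMeasurableFun.Build _ _ (measurableTypeR K) (measurableTypeR K) _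
  (measurable_shift t).
pose sh : {mfun measurableTypeR K >-> measurableTypeR K} :=
  HB.pack (fun x : measurableTypeR K => (x : K) - t : measurableTypeR K) sh_mixin.
have := @lebesgue_measure_unique K (pushforward leb sh).
apply => X [[a b] _ <-] /=.
rewrite /pushforward /=.
rewrite preimage_shift_itv !lebesgue_measure_itv /= !lte_fin ltrD2r.
by case: ifP => // _; rewrite -!EFinB opprD addrACA subrr addr0.
Qed.

(** Change of variables for the pushforward by the shift; the image measure is again Lebesgue
    measure. *)
Lemma ge0_integral_shift (t : K) (D : set K) (g : K -> \bar K) :
  measurable (D : set (measurableTypeR K)) ->
  measurable_fun (D : set (measurableTypeR K)) g ->
  (forall x, D x -> 0 <= g x)%E ->
  (\int[leb]_(x in (fun x => x - t)%R @^-1` D) g (x - t)%R = \int[leb]_(x in D) g x)%E.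
Proof.
move=> mD mg g0.
have := @ge0_integral_pushforward _ _ (measurableTypeR K) (measurableTypeR K) K
   _ (measurable_shift t) leb D g mD mg.
move=> <-; last by move=> x; rewrite inE; exact: g0.
apply: eq_measure_integral => A mA _; apply/esym.
exact: lebesgue_measure_shift.
Qed.
End translation.

(** * L^p estimates for functions close to a translate *)

Section lp_estimates.
Import Order.TTheory GRing.Theory Num.Theory.
Local Open Scope ring_scope.
Variable K : realType.
Local Notation oo a b := [set` Interval (BRight a%R) (BLeft b%R)].
Local Notation oc a b := [set` Interval (BRight a%R) (BRight b%R)].
Local Notation leb := (@lebesgue_measure K).

(** Absolute continuity of the integral, applied to the extension of [g] by zero to the whole
    line. *)
Lemma ge0_integral_left_tail_lt (g : K -> K) (a b e : K) :
  a < b -> measurable_fun (oo a b : set (measurableTypeR K)) g ->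
  (forall x, 0 <= g x) ->
  (\int[leb]_(x in oo a b) (g x)%:E < +oo)%E -> 0 < e ->
  exists2 d, 0 < d <= b - a & (\int[leb]_(x in oo (b - d) b) (g x)%:E < e%:E)%E.
Proof.
move=> ab mg g0 goo e0.
have intg : leb.-integrable (oo a b) (EFin \o g).
  apply/integrableP; split; first exact/measurable_EFinP.
  by under eq_integral do rewrite /= ger0_norm//.
have intgT : leb.-integrable setT (EFin \o patch (fun=> 0) (oo a b) g).
  by rewrite -restrict_EFin; apply/integrable_restrict => //=; rewrite setTI.
have [d [d0 tail]] := integral_normr_continuous intgT e0.
have d'0 : 0 < Num.min (d / 2) (b - a) by rewrite lt_min subr_gt0 ab divr_gt0.
(* Halving makes the measure of the tail strictly smaller than [d]; the cap [b - a] keeps the tail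
   inside the interval. *)
exists (Num.min (d / 2) (b - a)); first by rewrite d'0 ge_min lexx orbT.
move: d'0; set d' := Num.min _ _ => d'0.
have d'd : d' < d.
  by rewrite (@le_lt_trans _ _ (d / 2))// ?ge_min ?lexx// ltr_pdivrMr// ltr_pMr// ltr1n.
have ad' : a <= b - d' by rewrite lerBrDl -lerBrDr ge_min lexx orbT.
have sub : (oo (b - d') b) `<=` oo a b by apply: subset_itvr; rewrite bnd_simp.
have /tail : (leb (oo (b - d') b) < d%:E)%E.
  rewrite lebesgue_measure_itv /= lte_fin ltrBlDl ltrDr d'0 -EFinB lte_fin.
  by rewrite opprB addrCA subrr addr0.
move=> /(_ (measurable_itv _)); rewrite -lte_fin /Rintegral fineK.
  apply: le_lt_trans; rewrite le_eqVlt; apply/orP; left; apply/eqP.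
  apply: eq_integral => x; rewrite inE => /sub xab.
  by rewrite patchE mem_set// ger0_norm.
apply: integrable_fin_num => //.
have : leb.-integrable (oo (b - d') b) (EFin \o patch (fun=> 0) (oo a b) g).
  by apply: (integrableS _ _ _ intgT).
by move/integrable_abse.
Qed.

Lemma powR_add3_le (a b c p : K) : 0 <= a -> 0 <= b -> 0 <= c -> 0 <= p ->
  (a + b + c) `^ p <= 3 `^ p * (a `^ p + b `^ p + c `^ p).
Proof.
move=> a0 b0 c0 p0.
have le_max m : 0 <= m -> a <= m -> b <= m -> c <= m ->
    m `^ p <= a `^ p + b `^ p + c `^ p ->
    (a + b + c) `^ p <= 3 `^ p * (a `^ p + b `^ p + c `^ p).
  move=> m0 am bm cm mp; apply: (@le_trans _ _ ((3 * m) `^ p)).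
    by apply: ge0_ler_powR; rewrite ?nnegrE//; lra.
  by rewrite powRM// ler_wpM2l// powR_ge0.
have [pa pb pc] : [/\ 0 <= a `^ p, 0 <= b `^ p & 0 <= c `^ p] by rewrite !powR_ge0.
have [ab|ba] := leP a b; have [bc|cb] := leP b c; have [ac|ca] := leP a c.
all: try solve [apply: (le_max c); lra | apply: (le_max b); lra | apply: (le_max a); lra].
Qed.

(* For [h = |f - s|] and [g = |f|], where [s] is [e]-close to the translate
   [f (. - t)], the first bound on [h] comes from the uniform continuity of [f] away
   from [b]; near [b] only the triangle inequality is available. *)
Lemma integral_powR_near_translate_le (g h : K -> K) (a b d t e p : K) :
  0 <= p -> 0 <= e -> 0 < t <= d / 2 -> d <= b - a ->
  measurable_fun (oo a b : set (measurableTypeR K)) g ->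
  measurable_fun (oo a b : set (measurableTypeR K)) h ->
  (forall x, 0 <= g x) -> (forall x, 0 <= h x) ->
  (forall x, a < x <= b - d / 2 -> h x <= 3 * e) ->
  (forall x, b - d / 2 < x < b -> h x <= g x + g (x - t) + e) ->
  (\int[leb]_(x in oo a b) (h x `^ p)%:E <=
    (3 `^ p)%:E * (\int[leb]_(x in oo (b - d) b) (g x `^ p)%:E
       + \int[leb]_(x in oo (b - d) b) (g x `^ p)%:E
       + ((e `^ p) * (b - a))%:E))%E.
Proof.
move=> p0 e0 /andP[t0 td] dba mg mh g0 h0 hfar hnear.
(* [m] is the midpoint of the tail []b - d, b[]: since [t <= d / 2], moving []m, b[] left by [t]
   does not leave the tail. *)
pose m := b - d / 2.
have [am mb] : a <= m /\ m < b by rewrite /m; split; lra.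
have mpow (D : set (measurableTypeR K)) (u : K -> K) :
    measurable_fun D u -> measurable_fun D (fun x => (u x `^ p)%:E).
  move=> mu; apply/measurable_EFinP; rewrite -[X in measurable_fun _ X]/((fun x => x `^ p) \o u).
  by apply: measurableT_comp mu; exact: measurable_powR.
have pow0 (u : K -> K) x : (0 <= (u x `^ p)%:E)%E by rewrite lee_fin powR_ge0.
have itvU : (oo a b) = (oc a m) `|` (oo m b) :> set K.
  by rewrite -itv_bndbnd_setU ?bnd_simp.
have sub_far : (oc a m) `<=` oo a b by rewrite itvU; exact: subsetUl.
have sub_near : (oo m b) `<=` oo a b by rewrite itvU; exact: subsetUr.
have sub_tail : (oo (b - d) b) `<=` oo a b.
  by apply: subset_itvr; rewrite bnd_simp; lra.
have mgt : measurable_fun (oo (b - d) b : set (measurableTypeR K))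
    (fun x => (g x `^ p)%:E).
  by apply: mpow; exact: measurable_funS mg.
have tail_shift : (\int[leb]_(x in oo m b) (g (x - t)%R `^ p)%:E <=
    \int[leb]_(x in oo (b - d) b) (g x `^ p)%:E)%E.
  have -> : (oo m b) = (fun x => x - t) @^-1` (oo (m - t) (b - t)).
    by rewrite (preimage_shift_itv _ t false true) !subrK.
  have sub : (oo (m - t) (b - t)) `<=` (oo (b - d) b).
    by move=> x /=; rewrite !in_itv /= /m; lra.
  rewrite (@ge0_integral_shift _ t _ (fun x => (g x `^ p)%:E))//; last first.
    by apply: measurable_funS mgt.
  by apply: ge0_subset_integral => //.
have tail_sub : (\int[leb]_(x in oo m b) (g x `^ p)%:E <=
    \int[leb]_(x in oo (b - d) b) (g x `^ p)%:E)%E.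
  apply: ge0_subset_integral => //.
  by move=> x /=; rewrite !in_itv /= /m; lra.
(* [g] is measurable on []a, b[] only, so its translate is treated on []m, b[], where
   [x - t > b - d >= a]. *)
have mgs : measurable_fun (oo m b : set (measurableTypeR K)) (fun x => g (x - t)).
  apply: (@measurable_comp _ _ _ _ _ _ (oo a b : set (measurableTypeR K)) g) => //.
    have shift_in (x : K) : m < x < b -> a < x - t < b by rewrite /m; lra.
    by move=> _ [x + <-] /=; rewrite !in_itv /=; exact: shift_in.
  by apply: measurable_funB.
rewrite itvU ge0_integral_setU//; [|by rewrite -itvU; exact: mpow|]; last first.
  rewrite disj_set2E; apply/eqP/seteqP; split=> x //= []; rewrite !in_itv /=; lra.
pose A := (\int[leb]_(x in oo (b - d) b) (g x `^ p)%:E)%E; rewrite -/A.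
have far : (\int[leb]_(x in oc a m) (h x `^ p)%:E <=
    (3 `^ p)%:E * (e `^ p * (m - a))%:E)%E.
  apply: (@le_trans _ _ (\int[leb]_(x in oc a m) cst ((3 * e) `^ p)%:E x)%E).
    apply: ge0_le_integral => //.
    - by apply: mpow; exact: measurable_funS mh.
    - move=> x /=; rewrite in_itv /= => xm; rewrite lee_fin.
      by apply: ge0_ler_powR; rewrite ?nnegrE ?mulr_ge0//; exact: hfar.
  rewrite integral_cst//= lebesgue_measure_itv /= lte_fin powRM//.
  case: ifPn => [_|]; first by rewrite -EFinB -!EFinM lee_fin mulrA.
  by rewrite mule0 -EFinM lee_fin !mulr_ge0 ?powR_ge0 ?subr_ge0.
have near : (\int[leb]_(x in oo m b) (h x `^ p)%:E <=
    (3 `^ p)%:E * (A + A + (e `^ p * (b - m))%:E))%E.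
  apply: (@le_trans _ _ (\int[leb]_(x in oo m b)
     ((3 `^ p)%:E * ((g x `^ p)%:E + (g (x - t)%R `^ p)%:E + (e `^ p)%:E)))%E).
    apply: ge0_le_integral => //.
    - by apply: mpow; exact: measurable_funS mh.
    - apply: measurable_funeM; apply: emeasurable_funD => //.
      apply: emeasurable_funD; apply: mpow => //.
      exact: measurable_funS mg.
    - move=> x /=; rewrite in_itv /= => xm.
      rewrite -!EFinD -EFinM lee_fin; apply: le_trans (powR_add3_le _ _ _ _ _ _ _ _) => //.
      by apply: ge0_ler_powR; rewrite ?nnegrE ?addr_ge0//; exact: hnear.
  have mgn : measurable_fun (oo m b : set (measurableTypeR K))
      (fun x => (g x `^ p)%:E) by apply: mpow; exact: measurable_funS mg.
  rewrite ge0_integralZl//; last 2 first.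
    - apply: emeasurable_funD => //.
      by apply: emeasurable_funD => //; exact: mpow.
    - by move=> x _; rewrite -!EFinD lee_fin !addr_ge0 ?powR_ge0.
  apply: lee_wpmul2l; first exact: (pow0 (cst 3) 0).
  rewrite ge0_integralD//; last 3 first.
    - by move=> x _; rewrite -EFinD lee_fin addr_ge0 ?powR_ge0.
    - by apply: emeasurable_funD => //; exact: mpow.
    - by move=> x _; rewrite lee_fin powR_ge0.
  rewrite ge0_integralD//; last exact: mpow.
  apply: leeD; first exact: leeD.
  rewrite integral_cst//= lebesgue_measure_itv /= lte_fin mb.
  by rewrite -EFinB -EFinM.
apply: le_trans (leeD far near) _.
have A0 : (0 <= A)%E by apply: integral_ge0 => x _.
have AA0 : (0 <= A + A + (e `^ p * (b - m))%:E)%E.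
  apply: adde_ge0; first exact: adde_ge0.
  by rewrite lee_fin mulr_ge0 ?powR_ge0// subr_ge0 ltW.
have far0 : (0 <= (e `^ p * (m - a))%:E)%E.
  by rewrite lee_fin mulr_ge0 ?powR_ge0// subr_ge0.
rewrite -(ge0_muleDr _ far0 AA0).
(* The error terms of the two pieces add up, as their lengths [m - a] and [b - m] sum to [b - a]. *)
rewrite [X in (_ * X <= _)%E]addeCA -EFinD -mulrDr.
by have -> : m - a + (b - m) = b - a by lra.
Qed.
(* [e] absorbs the factors [3 `^ p] and [b - a]; as [e <= 1 <= p], also [e `^ p <= e]. *)
Lemma integral_powR_near_translate_lt (g : K -> K) (a b p eps : K) :
  1 <= p -> a < b -> 0 < eps ->
  measurable_fun (oo a b : set (measurableTypeR K)) g -> (forall x, 0 <= g x) ->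
  (\int[leb]_(x in oo a b) (g x `^ p)%:E < +oo)%E ->
  exists d e : K, [/\ 0 < d, d <= b - a, 0 < e &
    forall (t : K) (h : K -> K), 0 < t <= d / 2 ->
      measurable_fun (oo a b : set (measurableTypeR K)) h ->
      (forall x, 0 <= h x) ->
      (forall x, a < x <= b - d / 2 -> h x <= 3 * e) ->
      (forall x, b - d / 2 < x < b -> h x <= g x + g (x - t) + e) ->
      (\int[leb]_(x in oo a b) (h x `^ p)%:E < eps%:E)%E].
Proof.
move=> p1 ab eps0 mg g0 goo.
have p0 : 0 <= p by apply: le_trans p1.
have c0 : 0 < 3 `^ p :> K by rewrite powR_gt0.
have e10 : 0 < eps / (4 * 3 `^ p) by rewrite divr_gt0// mulr_gt0.
have mgp : measurable_fun (oo a b : set (measurableTypeR K)) (fun x => g x `^ p).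
  rewrite -[X in measurable_fun _ X]/((fun x => x `^ p) \o g).
  by apply: measurableT_comp mg; exact: measurable_powR.
have gp0 x : 0 <= g x `^ p by rewrite powR_ge0.
have [d /andP[d0 dab] tail] := ge0_integral_left_tail_lt _ _ _ _ ab mgp gp0 goo e10.
have ba0 : 0 < b - a by rewrite subr_gt0.
have e20 : 0 < Num.min 1 (eps / (4 * 3 `^ p) / (b - a)) by rewrite lt_min ltr01 divr_gt0.
exists d, (Num.min 1 (eps / (4 * 3 `^ p) / (b - a))); split=> // t h td mh h0 hfar hnear.
apply: (le_lt_trans (integral_powR_near_translate_le _ _ _ _ _ _ _ _ p0 (ltW e20)
  td dab mg mh g0 h0 hfar hnear)).
move: e20 {hfar hnear}; set e := Num.min _ _ => e20.
have ep : e `^ p * (b - a) <= eps / (4 * 3 `^ p).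
  rewrite -ler_pdivlMr//; apply: (@le_trans _ _ e); last by rewrite ge_min lexx orbT.
  rewrite -[leRHS]powRr1 ?(ltW e20)//; apply: ger_powR => //.
  by rewrite e20 ge_min lexx.
have tail0 : (0 <= \int[leb]_(x in oo (b - d) b) (g x `^ p)%:E)%E.
  by apply: integral_ge0 => x _; rewrite lee_fin.
(* The tail integral is nonnegative and below a real number, hence is itself a real number [A]. *)
move: tail tail0; case: (\int[leb]_(x in oo (b - d) b) _)%E => [A|//|//].
rewrite lte_fin => Ae _.
rewrite [X in (X < _)%E](_ : _ = (3 `^ p * (A + A + e `^ p * (b - a)))%:E)// lte_fin.
rewrite -ltr_pdivlMl// [ltRHS]mulrC.
have -> : eps / 3 `^ p = 4 * (eps / (4 * 3 `^ p)).
  by rewrite invfM !mulrA [4 * eps]mulrC mulfK.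
lra.
Qed.
End lp_estimates.

(** * Translates of Taylor-Dirichlet partial sums *)

(* Imported again: [Cpow] must mean the one of [Defs], not Coquelicot's. *)
Require Import Defs.

Local Open Scope R_scope.

Lemma Csum_ext (m : nat) (f g : nat -> C) :
  (forall k, (k < m)%nat -> f k = g k) -> Csum m f = Csum m g.
Proof.
elim: m => //= m IH fg; rewrite IH ?fg// => k km; apply: fg.
exact: ltnW.
Qed.

Lemma Csum_plus (m : nat) (f g : nat -> C) :
  Csum m (fun k => Cplus (f k) (g k)) = Cplus (Csum m f) (Csum m g).
Proof. by elim: m => /= [|m ->]; ring. Qed.

Lemma Csum_mult_l (m : nat) (a : C) (f : nat -> C) :
  Csum m (fun k => Cmult a (f k)) = Cmult a (Csum m f).
Proof. by elim: m => /= [|m ->]; ring. Qed.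

Lemma Csum_mult_r (m : nat) (a : C) (f : nat -> C) :
  Csum m (fun k => Cmult (f k) a) = Cmult (Csum m f) a.
Proof. by elim: m => /= [|m ->]; ring. Qed.

Lemma Csum_recl (m : nat) (f : nat -> C) :
  Csum m.+1 f = Cplus (f O) (Csum m (fun k => f k.+1)).
Proof.
elim: m => [|m IH]; first by rewrite /=; ring.
by rewrite [LHS]/= -/(Csum m.+1 f) IH /=; ring.
Qed.

(** Polynomial functions of degree less than [m], with zero alone for [m = 0]. Counting coefficients
    rather than degree matches the multiplicities [mu n]. *)
Definition poly_size_le (m : nat) (P : C -> C) : Prop :=
  exists d : nat -> C, forall z, P z = Csum m (fun k => Cmult (d k) (Cpow z k)).

Lemma poly_size_le_plus (m : nat) (P Q : C -> C) :
  poly_size_le m P -> poly_size_le m Q -> poly_size_le m (fun z => Cplus (P z) (Q z)).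
Proof.
move=> [d Pd] [e Qe]; exists (fun k => Cplus (d k) (e k)) => z.
by rewrite Pd Qe -Csum_plus; apply: Csum_ext => k _; ring.
Qed.

Lemma poly_size_le_scal (m : nat) (a : C) (P : C -> C) :
  poly_size_le m P -> poly_size_le m (fun z => Cmult a (P z)).
Proof.
move=> [d Pd]; exists (fun k => Cmult a (d k)) => z.
by rewrite Pd -Csum_mult_l; apply: Csum_ext => k _; ring.
Qed.

Lemma poly_size_le_widen (m : nat) (P : C -> C) :
  poly_size_le m P -> poly_size_le m.+1 P.
Proof.
move=> [d Pd]; exists (fun k => if (k < m)%nat then d k else RtoC 0) => z.
rewrite Pd /= ltnn Cmult_0_l Cplus_0_r.
by apply: Csum_ext => k ->.
Qed.

Lemma poly_size_le_mulX (m : nat) (P : C -> C) :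
  poly_size_le m P -> poly_size_le m.+1 (fun z => Cmult (P z) z).
Proof.
move=> [d Pd]; exists (fun k => if k is k'.+1 then d k' else RtoC 0) => z.
rewrite Pd Csum_recl Cmult_0_l Cplus_0_l -Csum_mult_r.
by apply: Csum_ext => k _ /=; ring.
Qed.

(** Induction through [(z - t)^(m+1) = (z - t)^m * z - t * (z - t)^m] replaces the binomial
    formula. *)
Lemma poly_size_le_Cpow_shift (t : C) (m : nat) :
  poly_size_le m.+1 (fun z => Cpow (Cminus z t) m).
Proof.
elim: m => [|m IH] /=; first by exists (fun=> RtoC 1) => z /=; ring.
have := poly_size_le_plus _ _ _ (poly_size_le_mulX _ _ IH)
  (poly_size_le_scal _ (Copp t) _ (poly_size_le_widen _ _ IH)).
move=> [d Hd]; exists d => z; rewrite -Hd; ring.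
Qed.

(** Translation does not raise the degree, so a translated block uses no powers beyond those allowed
    by its multiplicity. *)
Lemma poly_size_le_shift (m : nat) (c : nat -> C) (t : C) :
  poly_size_le m (fun z => Csum m (fun k => Cmult (c k) (Cpow (Cminus z t) k))).
Proof.
elim: m => [|m IH]; first by exists c.
apply: poly_size_le_plus; first exact: poly_size_le_widen.
by apply: poly_size_le_scal; exact: poly_size_le_Cpow_shift.
Qed.

Lemma Cexp_plus (z w : C) : Cexp (Cplus z w) = Cmult (Cexp z) (Cexp w).
Proof.
rewrite /Cexp /Cmult /Re /Im /= exp_plus Cos_plus.cos_plus Rtrigo1.sin_plus.
by congr pair; ring.
Qed.

(** The constant factor [e^(- lam_n t)] is absorbed into the coefficients of the translated
    polynomial. Each block is treated separately, so one family [d] serves every [N]. *)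
Lemma TD_partial_shift (c : nat -> nat -> C) (lam : nat -> C) (mu : nat -> nat) (t : C) :
  exists d, forall N z, TD_partial c lam mu N (Cminus z t) = TD_partial d lam mu N z.
Proof.
have /choice[d dP] n : exists d, forall z,
    Cmult (Cexp (Copp (Cmult (lam n) t)))
      (Csum (mu n) (fun k => Cmult (c n k) (Cpow (Cminus z t) k))) =
    Csum (mu n) (fun k => Cmult (d k) (Cpow z k)).
  by apply: poly_size_le_scal; exact: poly_size_le_shift.
exists d => N z; apply: Csum_ext => n _.
rewrite -dP (_ : Cmult (lam n) (Cminus z t) =
  Cplus (Cmult (lam n) z) (Copp (Cmult (lam n) t))); last by ring.
by rewrite Cexp_plus; ring.
Qed.

(** * Continuity of complex-valued functions of a real variable *)

(** Stated through real and imaginary parts so that the real theorems on continuity, uniform limits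
    and compact intervals apply to each. *)
Definition continuity_ptC (P : R -> C) (x : R) : Prop :=
  continuity_pt (fun y => Re (P y)) x /\ continuity_pt (fun y => Im (P y)) x.

Lemma continuity_ptC_const (a : C) (x : R) : continuity_ptC (fun=> a) x.
Proof. by split; apply: continuity_pt_const. Qed.

Lemma continuity_ptC_RtoC (x : R) : continuity_ptC RtoC x.
Proof.
by split; [apply: (derivable_continuous_pt id); exact: derivable_pt_id
          |apply: continuity_pt_const].
Qed.

Lemma continuity_ptC_plus (P Q : R -> C) (x : R) :
  continuity_ptC P x -> continuity_ptC Q x ->
  continuity_ptC (fun y => Cplus (P y) (Q y)) x.
Proof. by move=> [P1 P2] [Q1 Q2]; split; exact: continuity_pt_plus. Qed.

Lemma continuity_ptC_minus (P Q : R -> C) (x : R) :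
  continuity_ptC P x -> continuity_ptC Q x ->
  continuity_ptC (fun y => Cminus (P y) (Q y)) x.
Proof. by move=> [P1 P2] [Q1 Q2]; split; exact: continuity_pt_minus. Qed.

Lemma continuity_ptC_mult (P Q : R -> C) (x : R) :
  continuity_ptC P x -> continuity_ptC Q x ->
  continuity_ptC (fun y => Cmult (P y) (Q y)) x.
Proof.
move=> [P1 P2] [Q1 Q2]; split.
  by apply: continuity_pt_minus; exact: continuity_pt_mult.
by apply: continuity_pt_plus; exact: continuity_pt_mult.
Qed.

Lemma continuity_ptC_Cexp (P : R -> C) (x : R) :
  continuity_ptC P x -> continuity_ptC (fun y => Cexp (P y)) x.
Proof.
move=> [P1 P2].
have cexp : continuity_pt (fun y => exp (Re (P y))) x.
  apply: (continuity_pt_comp (fun y => Re (P y)) exp) => //.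
  by apply: derivable_continuous_pt; exact: derivable_pt_exp.
split; apply: continuity_pt_mult => //.
  by apply: (continuity_pt_comp (fun y => Im (P y)) Rtrigo_def.cos) => //;
    exact: continuity_cos.
by apply: (continuity_pt_comp (fun y => Im (P y)) Rtrigo_def.sin) => //;
  exact: continuity_sin.
Qed.

Lemma continuity_ptC_Csum (m : nat) (F : R -> nat -> C) (x : R) :
  (forall k, continuity_ptC (fun y => F y k) x) ->
  continuity_ptC (fun y => Csum m (F y)) x.
Proof.
move=> cF; elim: m => [|m IH]; first exact: continuity_ptC_const.
exact: continuity_ptC_plus.
Qed.

Lemma continuity_ptC_Cpow (k : nat) (x : R) : continuity_ptC (fun y => Cpow (RtoC y) k) x.
Proof.
elim: k => [|k IH]; first exact: continuity_ptC_const.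
by apply: continuity_ptC_mult => //; exact: continuity_ptC_RtoC.
Qed.

Lemma continuity_ptC_TD_partial (c : nat -> nat -> C) (lam : nat -> C) (mu : nat -> nat)
  (N : nat) (x : R) : continuity_ptC (fun y => TD_partial c lam mu N (RtoC y)) x.
Proof.
apply: continuity_ptC_Csum => n; apply: continuity_ptC_mult.
  apply: continuity_ptC_Csum => k; apply: continuity_ptC_mult.
    exact: continuity_ptC_const.
  exact: continuity_ptC_Cpow.
apply: continuity_ptC_Cexp; apply: continuity_ptC_mult.
  exact: continuity_ptC_const.
exact: continuity_ptC_RtoC.
Qed.

Lemma continuity_pt_Cmod (P : R -> C) (x : R) :
  continuity_ptC P x -> continuity_pt (fun y => Cmod (P y)) x.
Proof.
move=> [P1 P2].
apply: (continuity_pt_comp (fun y => Re (P y) ^ 2 + Im (P y) ^ 2) sqrt).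
  by apply: continuity_pt_plus; apply: continuity_pt_mult => //;
    apply: continuity_pt_mult => //; exact: continuity_pt_const.
apply: continuity_pt_sqrt.
by apply: Rplus_le_le_0_compat; exact: pow2_ge_0.
Qed.

Lemma Re_Im_le_Cmod (z : C) : Rabs (Re z) <= Cmod z /\ Rabs (Im z) <= Cmod z.
Proof.
by have := Rmax_Cmod z; split; apply: Rle_trans (Rmax_Cmod z);
  [exact: Rmax_l|exact: Rmax_r].
Qed.

Lemma Cmod_lt_Re_Im (z : C) (e : R) : Rabs (Re z) < e / 2 -> Rabs (Im z) < e / 2 -> Cmod z < e.
Proof.
move=> Hr Hi.
have -> : z = Cplus (RtoC (Re z)) (Cmult Ci (RtoC (Im z))).
  by case: z {Hr Hi} => a b; rewrite /Cplus /Cmult /=; congr pair; ring.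
apply: Rle_lt_trans (Cmod_triangle _ _) _.
rewrite Cmod_mult !Cmod_R.
have -> : Cmod Ci = 1.
  by rewrite /Cmod /Ci /= (_ : 0 * (0 * 1) + 1 * (1 * 1) = 1) ?sqrt_1//; ring.
Lra.lra.
Qed.

(** * Real segments in the sector and locally uniform limits on them *)

Lemma real_in_Theta (eta beta x : R) :
  eta < Rtrigo1.PI / 2 -> x < beta -> Theta eta beta (RtoC x).
Proof.
move=> etaPI xb; rewrite /Theta; case: Rlt_dec => //= eta0; split=> //.
rewrite Rabs_R0; apply: Rmult_le_pos; first exact: Rabs_pos.
by apply/Rlt_le/Rinv_0_lt_compat/tan_gt_0.
Qed.

(** Bolzano-Weierstrass for the real parts supplies a cluster point [l]; a subsequence converging to
    it is then built by recursion. *)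
Lemma compactC_segment (a b : R) : compactC (fun z => exists2 x, a <= x <= b & z = RtoC x).
Proof.
move=> u uab.
have vab n : a <= Re (u n) <= b by have [x xab ->] := uab n.
have uE n : u n = RtoC (Re (u n)) by have [x xab ->] := uab n.
have [l lP] := Bolzano_Weierstrass _ _ (compact_P3 a b) vab.
(* [next (k, N)] is an index at or beyond [N] whose term lies within [1 / (k + 1)] of [l]. *)
have /choice[next nextP] (kN : nat * nat) :
    exists p, (kN.2 <= p)%nat /\ Rabs (Re (u p) - l) < / INR kN.1.+1.
  have r0 : 0 < / INR kN.1.+1 by apply: Rinv_0_lt_compat; apply: lt_0_INR; apply/ltP.
  have [] := lP (disc l (mkposreal _ r0)) kN.2.
    by exists (mkposreal _ r0).
  by move=> p [/leP kp up]; exists p.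
(* Searching from [(phi n').+1] onwards makes [phi] strictly increasing. *)
pose phi := fix phi n := if n is n'.+1 then next (n, (phi n').+1) else next (n, O).
have phi_close n : Rabs (Re (u (phi n)) - l) < / INR n.+1.
  by case: n => [|n]; [have [] := nextP (O, O)|have [] := nextP (n.+1, (phi n).+1)].
have phi_eventually e : 0 < e ->
    exists N : nat, forall n, (N <= n)%nat -> Rabs (Re (u (phi n)) - l) < e.
  move=> e0; have [N [Ne N0]] := archimed_cor1 e e0; exists N => n Nn.
  apply: (Rlt_trans _ _ _ (phi_close n)); apply: Rle_lt_trans Ne.
  apply: Rinv_le_contravar; first exact: lt_0_INR.
  by apply: le_INR; apply/leP; exact: leqW.
exists phi, (RtoC l); split; first by move=> n; have [] := nextP (n.+1, (phi n).+1).
split.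
  (* Were [l] outside the segment, some term of the subsequence would be closer to [l] than the
     nearer endpoint is, hence outside as well. *)
  exists l => //; split.
    apply: Rnot_lt_le => la.
    have [|N /(_ N (leqnn N)) HN] := phi_eventually (a - l); first Lra.lra.
    have := vab (phi N); move/Rabs_def2: HN; Lra.lra.
  apply: Rnot_lt_le => la.
  have [|N /(_ N (leqnn N)) HN] := phi_eventually (l - b); first Lra.lra.
  have := vab (phi N); move/Rabs_def2: HN; Lra.lra.
move=> e /phi_eventually[N HN]; exists N => n /HN.
by rewrite uE -RtoC_minus Cmod_R.
Qed.

Section limit_on_reals.
Variables (eta beta : R) (s : nat -> C -> C) (f : C -> C).
Hypothesis eta_lt : eta < Rtrigo1.PI / 2.
Hypothesis s_cvg : unif_cvg_on_compacts (Theta eta beta) s f.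

Lemma unif_cvg_on_segment (a b e : R) : b < beta -> 0 < e ->
  exists N0 : nat, forall N, (N0 <= N)%nat ->
    forall x, a <= x <= b -> Cmod (Cminus (s N (RtoC x)) (f (RtoC x))) <= e.
Proof.
move=> bb e0; have [|N0 HN] := s_cvg _ (compactC_segment a b) _ e e0.
  by move=> _ [x xab ->]; apply: real_in_Theta => //; Lra.lra.
by exists N0 => N /HN{}HN x xab; apply: HN; exists x.
Qed.

(** A uniform limit of continuous functions is continuous; the neighbourhood of [x] of radius
    [(beta - x) / 2] lies in a segment ending before [beta]. *)
Lemma continuity_ptC_limit (x : R) :
  (forall N y, continuity_ptC (fun y => s N (RtoC y)) y) ->
  x < beta -> continuity_ptC (fun y => f (RtoC y)) x.
Proof.
move=> cs xb.
have r0 : 0 < (beta - x) / 2 by Lra.lra.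
have close e : 0 < e -> exists N0 : nat, forall N y, (N0 <= N)%coq_nat ->
    Boule x (mkposreal _ r0) y -> Cmod (Cminus (s N (RtoC y)) (f (RtoC y))) < e.
  move=> e0; have [||N0 HN] := unif_cvg_on_segment (x - (beta - x) / 2)
    (x + (beta - x) / 2) (e / 2); try Lra.lra.
  exists N0 => N y /leP /HN{}HN; rewrite /Boule /= => /Rabs_def2 yx.
  by apply: Rle_lt_trans (HN _ _) _; Lra.lra.
have xx : Boule x (mkposreal _ r0) x by rewrite /Boule Rminus_diag Rabs_R0.
split.
  apply: (CVU_continuity (fun N y => Re (s N (RtoC y))) _ x (mkposreal _ r0)) => //.
    move=> e /close[N0 HN]; exists N0 => N y /HN{}HN /HN{}HN.
    rewrite Rabs_minus_sym; apply: Rle_lt_trans HN.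
    exact: (Re_Im_le_Cmod (Cminus _ _)).1.
  by move=> N y _; exact: (cs N y).1.
apply: (CVU_continuity (fun N y => Im (s N (RtoC y))) _ x (mkposreal _ r0)) => //.
  move=> e /close[N0 HN]; exists N0 => N y /HN{}HN /HN{}HN.
  rewrite Rabs_minus_sym; apply: Rle_lt_trans HN.
  exact: (Re_Im_le_Cmod (Cminus _ _)).2.
by move=> N y _; exact: (cs N y).2.
Qed.
End limit_on_reals.

(** Heine's theorem for the real and the imaginary part, each with tolerance [e / 2]. *)
Lemma uniform_continuityC (P : R -> C) (a b e : R) : 0 < e ->
  (forall x, a <= x <= b -> continuity_ptC P x) ->
  exists2 d, 0 < d & forall x y, a <= x <= b -> a <= y <= b -> Rabs (x - y) < d ->
    Cmod (Cminus (P x) (P y)) < e.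
Proof.
move=> e0 cP; have e20 : 0 < e / 2 by Lra.lra.
have [d1 H1] := Heine _ _ (compact_P3 a b) (fun x xab => (cP x xab).1) (mkposreal _ e20).
have [d2 H2] := Heine _ _ (compact_P3 a b) (fun x xab => (cP x xab).2) (mkposreal _ e20).
exists (Rmin d1 d2); first by apply: Rmin_glb_lt; exact: cond_pos.
move=> x y xab yab xy; apply: Cmod_lt_Re_Im.
  by apply: H1 => //; apply: Rlt_le_trans xy (Rmin_l _ _).
by apply: H2 => //; apply: Rlt_le_trans xy (Rmin_r _ _).
Qed.

(** * Approximation of [f] in L^p by translated partial sums *)

Lemma IooE (a b : R) : Ioo a b = [set` Interval (BRight a) (BLeft b)].
Proof. by apply/seteqP; split=> x /=; rewrite in_itv /= => /andP. Qed.

Lemma continuity_pt_measurable_fun (h : R -> R) (a b : R) :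
  (forall x, x < b -> continuity_pt h x) ->
  @measurable_fun _ _ (measurableTypeR R) (measurableTypeR R)
    [set` Interval (BRight a) (BLeft b)] h.
Proof.
move=> ch; apply: open_continuous_measurable_fun; first exact: interval_open.
move=> x; rewrite inE /= in_itv /= => /andP[_ /RltP xb].
exact/continuity_pt_cvg/ch.
Qed.

Theorem theorem1p3 (lam : nat -> C) (mu : nat -> nat) (c : nat -> nat -> C)
  (eta gamma beta p : R) (f : C -> C) :
  class_ABC lam mu ->
  Stdlib.Reals.Raxioms.is_lub (fun x => exists n : nat, x = Rabs (Carg (lam n))) eta ->
  gamma < beta ->
  unif_cvg_on_compacts (Theta eta beta) (TD_partial c lam mu) f ->
  1 <= p ->
  @measurable_fun _ _ (measurableTypeR R) (measurableTypeR R) (Ioo gamma beta) (fun x : R => Re (f (RtoC x))) ->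
  @measurable_fun _ _ (measurableTypeR R) (measurableTypeR R) (Ioo gamma beta) (fun x : R => Im (f (RtoC x))) ->
  (\int[@lebesgue_measure R]_(x in (Ioo gamma beta))
      (powR (Cmod (f (RtoC x))) p)%:E < +oo)%E ->
  forall eps : R, 0 < eps ->
    exists (d : nat -> nat -> C) (N : nat),
      (\int[@lebesgue_measure R]_(x in (Ioo gamma beta))
         (powR (Cmod (Cminus (f (RtoC x)) (TD_partial d lam mu N (RtoC x)))) p)%:E
       < eps%:E)%E.
Proof.
move=> [_ [_ [[e0 [e0PI arg_le]] _]]] [_ eta_lub] gb s_cvg p1 _ _ fp eps eps0.
(* Condition (B) gives an upper bound [e0 < PI / 2] of all the arguments, and [eta] is the least
   one. *)
have eta_lt : eta < Rtrigo1.PI / 2.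
  by apply: Rle_lt_trans e0PI; apply: eta_lub => _ [n ->]; exact: arg_le.
have cf x : x < beta -> continuity_ptC (fun y => f (RtoC y)) x.
  apply: (continuity_ptC_limit _ _ _ _ eta_lt s_cvg) => N y.
  exact: continuity_ptC_TD_partial.
move: fp; rewrite IooE => fp.
have Cmod_ge0' (P : R -> C) x : (0 <= Cmod (P x))%R by apply/RleP; exact: Cmod_ge_0.
(* The choices are made in the order [d] and [e], then [dl], then [t], then [N]; the estimate
   [approx] holds for every admissible [t] and [h], so these may depend on [d] and [e]. *)
have [d [e [/RltP d_gt0 /RleP d_le /RltP e_gt0 approx]]] := integral_powR_near_translate_lt _
  (fun x => Cmod (f (RtoC x))) gamma beta p eps (introT RleP p1) (introT RltP gb)
  (introT RltP eps0)
  (continuity_pt_measurable_fun _ gamma beta (fun x xb => continuity_pt_Cmod _ _ (cf x xb)))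
  (Cmod_ge0' _) fp.
have [d0 db epos] : [/\ 0 < d, d <= beta - gamma & 0 < e] by split.
have d2E : (d / 2)%R = Rdiv d 2 by rewrite RdivE.
(* The segment starts at [gamma - d] so that it contains [x - t] as well as [x] when
   [gamma < x <= beta - d / 2]; it ends before [beta], where [f] is continuous. *)
have [x|dl dl0 f_unif] := uniform_continuityC (fun x => f (RtoC x))
    (gamma - d) (beta - d / 2) e epos.
  by move=> xb; apply: cf; Lra.lra.
(* Half of the minimum gives [t <= d / 2] together with the strict inequality [t < dl]. *)
pose t := Rmin dl d / 2.
have [t0 td tdl] : [/\ 0 < t, t <= d / 2 & t < dl].
  have := Rmin_l dl d; have := Rmin_r dl d; have := Rmin_glb_lt _ _ _ dl0 d0.
  by rewrite /t; split; Lra.lra.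
have [||N /(_ N (leqnn N)) HN] := unif_cvg_on_segment _ _ _ _ eta_lt s_cvg
  (gamma - t) (beta - t) e; try Lra.lra.
have [c' shift] := TD_partial_shift c lam mu (RtoC t).
exists c', N.
have close x : gamma < x < beta ->
    Cmod (Cminus (f (RtoC (x - t))) (TD_partial c' lam mu N (RtoC x))) <= e.
  move=> xgb; rewrite -shift -RtoC_minus -Cmod_opp.
  have -> : Copp (Cminus (f (RtoC (x - t))) (TD_partial c lam mu N (RtoC (x - t))))
    = Cminus (TD_partial c lam mu N (RtoC (x - t))) (f (RtoC (x - t))) by ring.
  by apply: HN; Lra.lra.
have split_diff x : Cmod (Cminus (f (RtoC x)) (TD_partial c' lam mu N (RtoC x))) <=
    Cmod (Cminus (f (RtoC x)) (f (RtoC (x - t)))) +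
    Cmod (Cminus (f (RtoC (x - t))) (TD_partial c' lam mu N (RtoC x))).
  apply: Rle_trans (Cmod_triangle _ _); apply: Req_le; congr Cmod; ring.
apply: (approx t).
- by apply/andP; split; apply/RleP || apply/RltP.
- apply: continuity_pt_measurable_fun => x xb; apply: continuity_pt_Cmod.
  by apply: continuity_ptC_minus; [exact: cf|exact: continuity_ptC_TD_partial].
- exact: Cmod_ge0'.
(* Away from [beta], uniform continuity and the approximation of the translate each cost at most
   [e], within the allowed [3 * e]. *)
- move=> x /andP[/RltP gx /RleP xm]; apply/RleP.
  have {}xm : x <= beta - d / 2 by move: xm; rewrite d2E.
  have -> : (3 * e)%R = Rmult 3 e by rewrite RmultE; congr (_ * _)%R; Lra.lra.
  apply: Rle_trans (split_diff x) _.
  have := close x; have := f_unif x (x - t).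
  rewrite (_ : x - (x - t) = t); last by ring.
  rewrite Rabs_pos_eq; last Lra.lra.
  by move=> H1 H2; have := H1 _ _ _; have := H2 _; Lra.lra.
(* Near [beta], the difference of [f] and its translate is bounded only by the sum of their
   moduli. *)
- move=> x /andP[/RltP xm /RltP xb]; apply/RleP.
  have {}xm : beta - d / 2 < x by move: xm; rewrite d2E.
  apply: Rle_trans (split_diff x) _.
  apply: Rplus_le_compat; last by apply: close; Lra.lra.
  apply: Rle_trans (Cmod_triangle _ _) _.
  by rewrite Cmod_opp; apply: Rle_refl.
Qed.
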